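(* For $k=2$ agents, no online exploration strategy on tadpole graphs has competitive ratio smaller than $1.5$ in the energy model.
   Context: Multi-agent online graph exploration: an undirected connected graph $G=(V,E)$ with positive edge lengths $l(e)$ and distinctly labelled nodes is initially unknown. $k$ agents start at a node $s$; initially they know $s$, its incident edges (with lengths) and its neighbours. Whenever an agent visits a node $v$ for the first time, all edges incident to $v$ (with lengths) and the neighbours of $v$ are revealed. Agents share all information instantly, have unlimited computation, move at unit speed, and may wait. The exploration is finished when every node has been visited and all agents are back at $s$. Energy model: cost is the maximum total distance travelled by any single agent. $opt(G,s,k)$ is the minimum cost of an exploration by $k$ agents with full prior knowledge of $G$; an online strategy has competitive ratio $c$ on a class if $c$ is the supremum of its cost divided by $opt(G,s,k)$ over all $G$ in the class and $s\in V$. A tadpole graph consists of a cycle together with a path (the tail, at least one edge) attached to one cycle node (the intersection, of degree 3); the other end of the tail has degree 1. *)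

(* Defs.v *)
From HB Require Import structures.
From mathcomp Require Import all_boot all_order all_algebra finmap.
From mathcomp Require Import boolp classical_sets reals constructive_ereal ereal.

Set Implicit Arguments.
Unset Strict Implicit.
Unset Printing Implicit Defensive.

Import Order.TTheory GRing.Theory Num.Theory.
Local Open Scope classical_set_scope.
Local Open Scope ring_scope.

(* Nodes are identified with their labels, which are natural numbers.  The
   value of [len u v] is meaningful only when [edge u v]. *)
Record graph (R : realType) := Graph {
  nodes : {fset nat};
  edge : rel nat;
  len : nat -> nat -> R;
  edge_sym : symmetric edge;
  edge_irr : irreflexive edge;
  edge_nodes : forall u v, edge u v -> (u \in nodes) && (v \in nodes);
  len_sym : forall u v, len u v = len v u;
  len_gt0 : forall u v, edge u v -> 0 < len u v;
  graph_connected : forall u v, u \in nodes -> v \in nodes ->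
    exists2 p, path edge u p & last u p = v }.

Definition steps (p : seq nat) : seq (nat * nat) := zip p (behead p).

(* The cycle is [c :: cs], the tail is [c :: ts], and [c] is the
   intersection. *)
Definition tadpole (R : realType) (G : graph R) : Prop :=
  exists c cs ts,
    [/\ (2 <= size cs)%N, (1 <= size ts)%N, uniq (c :: cs ++ ts),
        nodes G =i c :: cs ++ ts
      & let E := steps (rcons (c :: cs) c) ++ steps (c :: ts) in
        forall u v, edge G u v = ((u, v) \in E) || ((v, u) \in E)].

(* Points of the metric graph.  [mkpoint G u v x] is the point of the edge uv
   at distance x from u; an interior point is stored with its edge oriented
   from the smaller label to the larger one, so that equality of points is
   Leibniz equality. *)
Inductive point (R : realType) :=
  | Node of nat
  | Inner of nat & nat & R.
Arguments Node {R}.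

Definition mkpoint (R : realType) (G : graph R) (u v : nat) (x : R) : point R :=
  if x <= 0 then Node u
  else if len G u v <= x then Node v
  else if (u < v)%N then Inner u v x
  else Inner v u (len G u v - x).

(* A leg is a movement at unit speed along one edge, which starts at time
   [leg_start] and goes from distance [leg_x] to distance [leg_y] of the end
   [leg_u].  A leg may begin or end inside the edge, and [leg_y < leg_x] is
   allowed, so agents may stop and turn around anywhere.  An agent waits
   between two consecutive legs and after the last one. *)
Record leg (R : realType) := Leg {
  leg_start : R;
  leg_u : nat;
  leg_v : nat;
  leg_x : R;
  leg_y : R }.

Definition leg_len (R : realType) (g : leg R) : R := `|leg_y g - leg_x g|.

Definition leg_end (R : realType) (g : leg R) : R := leg_start g + leg_len g.

Definition leg_pos (R : realType) (G : graph R) (g : leg R) (t : R) : point R :=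
  mkpoint G (leg_u g) (leg_v g)
    (leg_x g + Num.sg (leg_y g - leg_x g)
               * (Num.min t (leg_end g) - leg_start g)).

(* [route G q p t gs]: an agent that is at [p] at time [t] can carry out the
   legs [gs], and then it is at [q]. *)
Fixpoint route (R : realType) (G : graph R) (q p : point R) (t : R)
    (gs : seq (leg R)) : Prop :=
  if gs is g :: gs' then
    [/\ t <= leg_start g,
        edge G (leg_u g) (leg_v g),
        0 <= leg_x g <= len G (leg_u g) (leg_v g)
          /\ 0 <= leg_y g <= len G (leg_u g) (leg_v g),
        p = mkpoint G (leg_u g) (leg_v g) (leg_x g)
      & route G q (mkpoint G (leg_u g) (leg_v g) (leg_y g)) (leg_end g) gs']
  else p = q.

Fixpoint pos_at (R : realType) (G : graph R) (p : point R) (gs : seq (leg R))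
    (t : R) : point R :=
  if gs is g :: gs' then
    if t < leg_start g then p else pos_at G (leg_pos G g t) gs' t
  else p.

Definition schedule (R : realType) (k : nat) := 'I_k -> seq (leg R).

Definition visited (R : realType) (k : nat) (G : graph R) (s : nat)
    (P : schedule R k) (t : R) : set nat :=
  [set v | exists (i : 'I_k) (t' : R),
     0 <= t' <= t /\ pos_at G (Node s) (P i) t' = Node v].

Definition exploration (R : realType) (k : nat) (G : graph R) (s : nat)
    (P : schedule R k) : Prop :=
  (forall i, route G (Node s) (Node s) 0 (P i)) /\
  (forall v, v \in nodes G -> exists t, visited G s P t v).

Definition energy (R : realType) (k : nat) (P : schedule R k) : R :=
  \big[Num.max/0]_(i < k) \sum_(g <- P i) leg_len g.

Definition opt (R : realType) (G : graph R) (s k : nat) : R :=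
  inf [set energy P | P in [set P : schedule R k | exploration G s P]].

(* At time [t] the agents know the nodes visited up to then, the edges at these
   nodes with their lengths, and hence the labels of the neighbours. *)
Definition same_knowledge (R : realType) (k : nat)
    (G1 : graph R) (s1 : nat) (P1 : schedule R k)
    (G2 : graph R) (s2 : nat) (P2 : schedule R k) (t : R) : Prop :=
  visited G1 s1 P1 t = visited G2 s2 P2 t /\
  (forall u v, visited G1 s1 P1 t u ->
     edge G1 u v = edge G2 u v /\ (edge G1 u v -> len G1 u v = len G2 u v)).

(* A deterministic strategy with unlimited computation is the map sending each
   instance to the schedule that results on it.  It is online when the
   positions at time [t] are determined by the knowledge held before [t]. *)
Definition strategy (R : realType) (k : nat) := graph R -> nat -> schedule R k.

Definition online (R : realType) (k : nat) (C : graph R -> Prop)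
    (A : strategy R k) : Prop :=
  forall G1 s1 G2 s2,
    C G1 -> s1 \in nodes G1 -> C G2 -> s2 \in nodes G2 ->
  forall t, 0 < t ->
    (forall t', 0 <= t' < t ->
       same_knowledge G1 s1 (A G1 s1) G2 s2 (A G2 s2) t') ->
  forall i, pos_at G1 (Node s1) (A G1 s1 i) t =
            pos_at G2 (Node s2) (A G2 s2 i) t.

Definition online_exploration_strategy (R : realType) (k : nat)
    (C : graph R -> Prop) (A : strategy R k) : Prop :=
  (forall G s, C G -> s \in nodes G -> exploration G s (A G s)) /\ online C A.

Definition competitive_ratio (R : realType) (k : nat) (C : graph R -> Prop)
    (A : strategy R k) : \bar R :=
  ereal_sup [set r | exists G s,
    [/\ C G, s \in nodes G & r = (energy (A G s) / opt G s k)%:E]].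

(* Main.v *)
(** Put the start [0] at the intersection, with three edges of length 1 to
    1, 2 and 3.  In the instance (f, g, t) the cycle is 0 - f - 4 - g - 0, where
    f4 has length 6 and 4g has a tiny length d, and the tail is 0 - t - 5.
    Offline, one agent visits f, g, 4 without using the edge f4 and the other
    one visits t, 5, so the optimum is at most 4 + 2d.

    Suppose that an online strategy always pays less than 6.  Then the agent
    that reaches 5 visits neither f nor g; hence the other one visits both, and
    it does not visit t.  Also 4 is never reached before g, because the edge f4
    is too long.  Let f be the first visited node among 1, 2, 3.  Up to the next
    new node u, the instances (f, g, t) and (f, t, g) look alike, and u is one of
    the other two neighbours of 0.  In one of the two instances u is on the
    cycle and must be visited by the agent that visited f; in the other one u is
    on the tail and must be visited by the other agent.  But the strategy acts in
    the same way in both. *)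
From mathcomp Require Import all_boot all_order all_algebra finmap ring lra.
From mathcomp Require Import boolp classical_sets reals constructive_ereal ereal.
Require Import Defs.

Set Implicit Arguments.
Unset Strict Implicit.
Unset Printing Implicit Defensive.

Import Order.TTheory GRing.Theory Num.Theory.
Local Open Scope ring_scope.

(** * Motion along routes *)

Section Motion.
Variables (R : realType) (G : graph R).
Implicit Types (g : leg R) (gs : seq (leg R)) (p q : point R) (t x y : R).

Lemma leg_len_ge0 g : 0 <= leg_len g.
Proof. exact: normr_ge0. Qed.

Lemma leg_start_le_end g : leg_start g <= leg_end g.
Proof. by rewrite lerDl leg_len_ge0. Qed.

Lemma leg_pos_start g :
  leg_pos G g (leg_start g) = mkpoint G (leg_u g) (leg_v g) (leg_x g).
Proof. by rewrite /leg_pos (min_l (leg_start_le_end g)) subrr mulr0 addr0. Qed.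

Lemma leg_pos_end g t :
  leg_end g <= t -> leg_pos G g t = mkpoint G (leg_u g) (leg_v g) (leg_y g).
Proof.
move=> le_t; rewrite /leg_pos (min_r le_t) /leg_end addrAC subrr add0r.
by rewrite /leg_len -numEsg addrC subrK.
Qed.

(** The odometer reading at time [t]: [Num.min] counts a leg in progress only for the part already
    carried out. *)
Fixpoint travel gs t : R :=
  if gs is g :: gs' then
    if t < leg_start g then 0
    else Num.min t (leg_end g) - leg_start g + travel gs' t
  else 0.

Lemma pos_at_lt q p p' t gs t' : route G q p t gs -> t' < t ->
  pos_at G p' gs t' = p' /\ travel gs t' = 0.
Proof.
by case: gs => [//|g gs] /= [le_t _ _ _ _] /lt_le_trans/(_ le_t) ->.
Qed.

Lemma pos_at_le q p t gs t' : route G q p t gs -> t' <= t ->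
  pos_at G p gs t' = p /\ travel gs t' = 0.
Proof.
elim: gs p t t' => [//|g gs IH] p t t' /= [le_t _ _ -> rt] le_t't.
case: ltP => // le_g.
have {le_g le_t le_t't} -> : t' = leg_start g.
  by apply/le_anti; rewrite le_g (le_trans le_t't le_t).
rewrite leg_pos_start (min_l (leg_start_le_end g)) subrr add0r.
(* A leg of length 0 may be followed by another one at the same instant, hence the induction; after
   a longer leg the rest starts strictly later. *)
have := leg_len_ge0 g; rewrite le_eqVlt => /predU1P[len0|len_gt0].
  have : leg_x g = leg_y g.
    by apply/esym/eqP; rewrite -subr_eq0 -normr_eq0 -/(leg_len g) -len0.
  by move=> eq_xy; rewrite eq_xy; exact: IH rt (leg_start_le_end g).
by apply: pos_at_lt rt _; rewrite /leg_end ltrDl.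
Qed.

Lemma route_end q p t gs t0 : route G q p t gs ->
  exists T, [/\ t <= T, t0 <= T, pos_at G p gs T = q
              & travel gs T = \sum_(g <- gs) leg_len g].
Proof.
elim: gs p t => [|g gs IH] p t /=.
  move=> ->; exists (Num.max t t0).
  by rewrite big_nil !le_max !lexx orbT.
move=> [le_t _ _ -> rt]; have [T [le_T le_0T posT trT]] := IH _ _ rt.
have le_sT := le_trans (leg_start_le_end g) le_T.
exists T; split=> //; first exact: le_trans le_sT.
  by rewrite ltNge le_sT /= (leg_pos_end le_T).
rewrite ltNge le_sT /= big_cons trT (min_r le_T).
by rewrite /leg_end [_ + leg_len g]addrC addrK.
Qed.

Lemma route_visit q p t gs g : route G q p t gs -> List.In g gs ->
  exists2 t', t <= t' &
    pos_at G p gs t' = mkpoint G (leg_u g) (leg_v g) (leg_y g).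
Proof.
elim: gs p t => [//|g' gs IH] p t /= [le_t _ _ -> rt].
have le_e := leg_start_le_end g'.
case=> [eq_g|g_in].
  subst g'.
  exists (leg_end g); first exact: le_trans le_t le_e.
  by rewrite ltNge le_e /= (leg_pos_end (lexx _)); have [] := pos_at_le rt (lexx _).
have [t' le_t' post'] := IH _ _ rt g_in.
exists t'; first exact: le_trans (le_trans le_t le_e) le_t'.
by rewrite ltNge (le_trans le_e le_t') /= (leg_pos_end le_t').
Qed.

(* A 1-Lipschitz motion can only reach a node at once after [t] if it is there
   already at [t]. *)
Definition right_stable (P : R -> point R) t :=
  exists2 e, 0 < e &
    forall t' v, t < t' < t + e -> P t' = Node v -> P t = Node v.

(** The coordinate along the edge is 1-Lipschitz in time, so an end of the edge that is not occupied
    at [t] stays out of reach for a short while. *)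
Lemma leg_pos_right_stable g t :
  edge G (leg_u g) (leg_v g) -> leg_start g <= t ->
  right_stable (leg_pos G g) t.
Proof.
move=> /len_gt0; set l := len _ _ _ => l_gt0 le_t.
pose c t := leg_x g + Num.sg (leg_y g - leg_x g)
               * (Num.min t (leg_end g) - leg_start g).
have lip t' : t < t' -> `|c t' - c t| <= t' - t.
  move=> lt_t; rewrite /c.
  have : Num.sg (leg_y g - leg_x g) \in [:: 0; 1; -1].
    by case: sgrP; rewrite !inE eqxx ?orbT.
  rewrite !inE => /or3P[] /eqP ->;
    case: (leP t' (leg_end g)) => ?; case: (leP t (leg_end g)) => ?;
    rewrite ler_norml; apply/andP; split; lra.
(* The distance to the nearer end not occupied at [t]; for an occupied end the harmless value [l] is
   used. *)
pose e := Num.min l (Num.min (if c t == 0 then l else `|c t|)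
                             (if c t == l then l else `|c t - l|)).
have e_gt0 : 0 < e.
  rewrite !lt_min l_gt0 /=.
  by apply/andP; split; case: eqVneq => // ?; rewrite normr_gt0 ?subr_eq0.
exists e => // t' v /andP[lt_t lt_e].
have {}lip := lip _ lt_t.
have {e_gt0}: `|c t' - c t| < e by apply: le_lt_trans lip _; lra.
rewrite !lt_min /leg_pos -!/(c _) /mkpoint -/l => /and3P[].
case: (eqVneq (c t) 0) => [->|ct0].
  rewrite lexx; case: (leP (c t') 0) => // ct'0 lt_l _ _.
  have -> : l <= c t' = false.
    by apply/negbTE; rewrite -ltNge; move: lt_l; rewrite subr0 gtr0_norm.
  by case: ifP.
case: (eqVneq (c t) l) => [->|ctl].
  rewrite lexx [l <= 0]leNgt l_gt0 /= => lt_l _ _.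
  have -> : c t' <= 0 = false.
    by apply/negbTE; rewrite -ltNge; move: lt_l; rewrite ltr_norml; lra.
  by case: (leP l (c t')) => // _; case: ifP.
rewrite !ltr_norml => _ /andP[h1 h2] /andP[h3 h4].
move: ct0 ctl h1 h2 h3 h4; rewrite !neq_lt => /orP[] ct0 /orP[] ctl.
- rewrite (ltr0_norm ct0) => h1 h2 h3 h4; rewrite (ltW ct0).
  by have -> : c t' <= 0 by lra.
- by exfalso; lra.
- rewrite (gtr0_norm ct0) ltr0_norm ?subr_lt0// => h1 h2 h3 h4.
  have -> : c t' <= 0 = false by apply/negbTE; rewrite -ltNge; lra.
  have -> : l <= c t' = false by apply/negbTE; rewrite -ltNge; lra.
  by case: ifP.
- rewrite (gtr0_norm ct0) gtr0_norm ?subr_gt0// => h1 h2 h3 h4.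
  have -> : c t' <= 0 = false by apply/negbTE; rewrite -ltNge; lra.
  have -> : l <= c t' by lra.
  by rewrite leNgt ct0 /= (ltW ctl).
Qed.

Lemma pos_at_right_stable q p t0 gs t :
  route G q p t0 gs -> right_stable (pos_at G p gs) t.
Proof.
(* The recursion of [pos_at] replaces the initial point by one that depends on time, so the claim is
   generalized to a moving initial point [P]. *)
suff H P : right_stable P t -> route G q p t0 gs ->
    right_stable (fun t => pos_at G (P t) gs t) t.
  by apply: H; exists 1.
elim: gs p t0 P => [//|g gs IH] p t0 P stP /= [_ ed _ _ rt].
case: (ltP t (leg_start g)) => [lt_t|le_t].
  have [e e0 He] := stP.
  exists (Num.min e (leg_start g - t)); first by rewrite lt_min e0 subr_gt0.
  move=> t' v /andP[lt_tt'].
  rewrite -ltrBlDl lt_min => /andP[? ?]; rewrite lt_t.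
  have -> : t' < leg_start g by lra.
  by apply: He; rewrite lt_tt' /=; lra.
have [e e0 He] := IH _ _ _ (leg_pos_right_stable ed le_t) rt.
exists e => // t' v /[dup] /andP[lt_t _].
rewrite /= [t < leg_start g]ltNge le_t /=.
by rewrite [t' < leg_start g]ltNge (le_trans le_t (ltW lt_t)) /=; exact: He.
Qed.

End Motion.

(** * Potentials *)

(** Cuts a time interval at [m]; applied at the start and at the end of a leg. *)
Lemma glue_le (R : realType) (D : R -> R -> Prop) m :
  (forall a b c, a <= b -> b <= c -> D a b -> D b c -> D a c) ->
  (forall a b, a <= b -> b <= m -> D a b) ->
  (forall a b, m <= a -> a <= b -> D a b) ->
  forall a b, a <= b -> D a b.
Proof.
move=> tr Dl Dr a b le_ab.
case: (leP b m) => [le_bm|/ltW le_mb]; first exact: Dl.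
case: (leP m a) => [le_ma|/ltW le_am]; first exact: Dr.
by apply: (tr a m b) => //; [exact: Dl | exact: Dr].
Qed.

Section Potential.
Variables (R : realType) (G : graph R).
Variables (k : nat -> R) (L : nat -> nat -> R) (B : pred nat).

(* A potential that is affine on every edge; [L u v] is its value at the end
   [u] of the edge uv, and it may differ from the value [k u] at the node only
   if [u] belongs to the cut [B]. *)
Definition potential (p : point R) : R :=
  match p with
  | Node u => k u
  | Inner u v x => L u v + (L v u - L u v) * (x / len G u v)
  end.

Hypothesis L_lip : forall u v, edge G u v -> `|L v u - L u v| <= len G u v.
Hypothesis L_node : forall u v, edge G u v -> ~~ B u -> L u v = k u.

Definition avoids (p : point R) := forall u, B u -> p <> Node u.

Lemma potential_mkpoint u v x : edge G u v -> 0 <= x <= len G u v ->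
  avoids (mkpoint G u v x) ->
  potential (mkpoint G u v x) = L u v + (L v u - L u v) * (x / len G u v).
Proof.
move=> ed /andP[x0 xl]; have l0 := len_gt0 ed.
have edV : edge G v u by rewrite edge_sym.
rewrite /mkpoint; case: (leP x 0) => [le_x0|lt_0x] av.
  have -> : x = 0 by apply/le_anti; rewrite le_x0.
  rewrite mul0r mulr0 addr0 /= (L_node ed)//.
  by apply/negP => /av; apply.
case: (leP _ x) av => [le_lx|lt_xl] av.
  have -> : x = len G u v by apply/le_anti; rewrite le_lx xl.
  rewrite divff ?gt_eqF// mulr1 addrC subrK /= (L_node edV)//.
  by apply/negP => /av; apply.
case: ifP => //= _; rewrite (len_sym G v u).
have -> : (len G u v - x) / len G u v = 1 - x / len G u v.
  by rewrite mulrBl divff ?gt_eqF.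
by ring.
Qed.

Lemma potential_lip u v x y : edge G u v ->
  0 <= x <= len G u v -> 0 <= y <= len G u v ->
  avoids (mkpoint G u v x) -> avoids (mkpoint G u v y) ->
  `|potential (mkpoint G u v y) - potential (mkpoint G u v x)| <= `|y - x|.
Proof.
move=> ed hx hy ax ay; rewrite !potential_mkpoint//.
have l0 := len_gt0 ed.
rewrite opprD addrACA subrr add0r -mulrBr -mulrBl normrM normrM normfV.
rewrite (gtr0_norm l0) mulrCA ler_piMr//.
by rewrite ler_pdivrMr// mul1r L_lip.
Qed.

Lemma leg_coord_in g t : leg_start g <= t ->
  0 <= leg_x g <= len G (leg_u g) (leg_v g) ->
  0 <= leg_y g <= len G (leg_u g) (leg_v g) ->
  0 <= leg_x g + Num.sg (leg_y g - leg_x g)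
               * (Num.min t (leg_end g) - leg_start g) <= len G (leg_u g) (leg_v g).
Proof.
move=> le_t /andP[hx0 hx1] /andP[hy0 hy1].
have : leg_start g <= Num.min t (leg_end g) <= leg_end g.
  by rewrite le_min le_t leg_start_le_end ge_min lexx orbT.
rewrite /leg_end /leg_len; move: (Num.min _ _) => m /andP[m1 m2].
by case: sgrP m2 => h m2; apply/andP; split; lra.
Qed.

(** Along an edge the potential has slope at most 1 by [L_lip], and its jumps sit at nodes of [B],
    which the motion avoids. So it changes by at most the distance travelled. *)
Lemma potential_le_travel q p t0 gs : route G q p t0 gs ->
  forall a b, a <= b -> (forall t, a <= t <= b -> avoids (pos_at G p gs t)) ->
  `|potential (pos_at G p gs b) - potential (pos_at G p gs a)|
    <= travel gs b - travel gs a.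
Proof.
pose D p gs a b := (forall t, a <= t <= b -> avoids (pos_at G p gs t)) ->
  `|potential (pos_at G p gs b) - potential (pos_at G p gs a)|
    <= travel gs b - travel gs a.
have Dtr p' gs' a b c : a <= b -> b <= c -> D p' gs' a b -> D p' gs' b c ->
    D p' gs' a c.
  move=> ab bc D1 D2 av.
  have /D1 {}D1 : forall t, a <= t <= b -> avoids (pos_at G p' gs' t).
    by move=> t /andP[h1 h2]; apply: av; rewrite h1 (le_trans h2).
  have /D2 {}D2 : forall t, b <= t <= c -> avoids (pos_at G p' gs' t).
    by move=> t /andP[h1 h2]; apply: av; rewrite h2 (le_trans ab).
  rewrite (le_trans (ler_distD (potential (pos_at G p' gs' b)) _ _))//.
  by rewrite (le_trans (lerD D2 D1))//; lra.
elim: gs p t0 => [|g gs IH] p t0 /=.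
  by move=> _ a b _ _; rewrite !subrr normr0.
move=> [le_t ed [hx hy] eq_p rt].
have rt0 : route G q p (leg_start g) (g :: gs) by [].
have le_se := leg_start_le_end g.
apply: (@glue_le _ (D p (g :: gs)) (leg_start g)); first exact: Dtr.
  move=> a b le_ab le_b _.
  have [-> ->] := pos_at_le rt0 le_b.
  have [-> ->] := pos_at_le rt0 (le_trans le_ab le_b).
  by rewrite !subrr normr0.
move=> a b le_a le_ab; move: a b le_ab le_a.
(* Before the leg nothing moves. What remains is cut at the end of the leg: first the motion is
   [leg_pos], afterwards the induction hypothesis applies. *)
suff H a b : a <= b -> leg_start g <= a -> D p (g :: gs) a b by exact: H.
apply: (@glue_le _ (fun a b => leg_start g <= a -> D p (g :: gs) a b)
  (leg_end g)) => {a b}.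
- move=> a b c ab bc D1 D2 le_a.
  by apply: Dtr ab bc (D1 le_a) (D2 (le_trans le_a ab)).
- move=> a b le_ab le_b le_a; rewrite /D.
  have le_a' := le_trans le_ab le_b; have le_sb := le_trans le_a le_ab.
  have posE t : leg_start g <= t -> t <= leg_end g ->
      pos_at G p (g :: gs) t = leg_pos G g t /\ travel (g :: gs) t = t - leg_start g.
    move=> le_st le_te; rewrite /= ltNge le_st /= (min_l le_te).
    have [lt_te|lt_et|eq_te] := ltgtP t (leg_end g).
    - by have [-> ->] := pos_at_lt (leg_pos G g t) rt lt_te; rewrite addr0.
    - by move: le_te; rewrite leNgt lt_et.
    - have := pos_at_le rt le_te.
      by rewrite eq_te (leg_pos_end _ (lexx _)) => -[-> ->]; rewrite addr0.
  have [-> ->] := posE _ le_sb le_b; have [-> ->] := posE _ le_a le_a'.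
  move=> av.
  have ava := av a; have avb := av b.
  rewrite (posE _ le_sb le_b).1 in avb; rewrite (posE _ le_a le_a').1 in ava.
  rewrite /leg_pos (le_trans (potential_lip ed _ _ _ _)) ?leg_coord_in//.
  + by apply: ava; rewrite lexx.
  + by apply: avb; rewrite lexx andbT.
  rewrite opprD addrACA subrr add0r -mulrBr normrM.
  rewrite (min_l le_b) (min_l le_a').
  have -> : b - leg_start g - (a - leg_start g) = b - a by lra.
  rewrite (ger0_norm (_ : 0 <= b - a)) ?subr_ge0// ler_piMl ?subr_ge0//.
  by rewrite normr_sg; case: (_ != 0); rewrite ?ler01 ?lexx.
- move=> a b le_a le_ab _; rewrite /D /=.
  have le_b := le_trans le_a le_ab.
  rewrite !ltNge !(le_trans le_se _)//= !leg_pos_end// !min_r//.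
  have -> x y z w : w - y + x - (w - y + z) = x - z :> R by lra.
  move=> av; apply: IH rt _ _ le_ab _ => t /[dup] hab /av.
  have le_et : leg_end g <= t by case/andP: hab => /(le_trans le_a).
  by rewrite ltNge (le_trans le_se le_et) /= (leg_pos_end _ le_et).
Qed.

End Potential.

(** * First visits and agreement of runs *)

Section FirstVisit.
Variables (R : realType) (k : nat).
Implicit Types (G : graph R) (s : nat) (P : schedule R k) (U : pred nat).

Definition unvisited_before G s P U (T : R) :=
  forall t i u, 0 <= t < T -> U u -> pos_at G (Node s) (P i) t <> Node u.

Lemma schedule_right_stable G s P t :
  (forall i, route G (Node s) (Node s) 0 (P i)) ->
  exists2 e, 0 < e &
    forall i t' v, t < t' < t + e -> pos_at G (Node s) (P i) t' = Node v ->
      pos_at G (Node s) (P i) t = Node v.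
Proof.
move=> rt.
have /choice[e He] : forall i, exists e, 0 < e /\ forall t' v, t < t' < t + e ->
    pos_at G (Node s) (P i) t' = Node v -> pos_at G (Node s) (P i) t = Node v.
  by move=> i; have [e e0 He] := pos_at_right_stable t (rt i); exists e.
exists (\big[Num.min/1]_i e i).
  by apply: lt_bigmin => // i _; have [] := He i.
move=> i t' v /andP[lt_t]; rewrite -ltrBlDl => /lt_le_trans/(_ (bigmin_le _ i _)).
by rewrite ltrBlDl => lt_t'; apply: (He i).2; rewrite lt_t.
Qed.

(** The infimum of the visit times is attained: by right stability, a visit just after it is already
    taking place at it. *)
Lemma first_visit G s P U t0 i0 u0 :
  (forall i, route G (Node s) (Node s) 0 (P i)) ->
  0 <= t0 -> pos_at G (Node s) (P i0) t0 = Node u0 -> U u0 ->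
  exists t i u, [/\ 0 <= t, pos_at G (Node s) (P i) t = Node u, U u
                  & unvisited_before G s P U t].
Proof.
move=> rt t00 pos0 U0.
pose S := [set t : R | 0 <= t /\
  exists i u, pos_at G (Node s) (P i) t = Node u /\ U u]%classic.
have infS : has_inf S.
  by split; [exists t0; split=> //; exists i0, u0 | exists 0 => t []].
pose T := inf S; have leT t : S t -> T <= t by apply: inf_lbound; case: infS.
have T0 : 0 <= T by apply: lb_le_inf; [case: infS | move=> t []].
have [_ [i [u [posT Uu]]]] : S T.
  have [e e0 He] := schedule_right_stable T rt.
  have [b Sb lt_b] := inf_adherent e0 infS.
  have := leT b Sb; rewrite le_eqVlt => /predU1P[-> //|lt_Tb].
  case: Sb => _ [i [u [posb Uu]]]; split=> //; exists i, u; split=> //.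
  by apply: He posb; rewrite lt_Tb.
exists T, i, u; split=> // t j v /andP[t_ge0 lt_tT] Uv post.
suff /leT : S t by rewrite leNgt lt_tT.
by split=> //; exists j, v.
Qed.

(** Let [b0] be the infimum of the times at which the runs differ. They agree before [b0], hence at
    [b0] by the online property. By right stability no new node is visited just after [b0], so the
    knowledge does not grow there and the agreement extends beyond [b0], a contradiction. *)
Lemma online_agree (C : graph R -> Prop) (A : strategy R k) G1 G2 s U T :
  online C A -> C G1 -> C G2 -> s \in nodes G1 -> s \in nodes G2 ->
  (forall i, route G1 (Node s) (Node s) 0 (A G1 s i)) ->
  (forall i, route G2 (Node s) (Node s) 0 (A G2 s i)) ->
  (forall u v, ~~ U u -> edge G1 u v = edge G2 u v /\ len G1 u v = len G2 u v) ->
  unvisited_before G1 s (A G1 s) U T ->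
  forall t i, 0 <= t <= T ->
    pos_at G1 (Node s) (A G1 s i) t = pos_at G2 (Node s) (A G2 s i) t.
Proof.
move=> onA C1 C2 s1 s2 rt1 rt2 eqU unT.
pose S := [set t : R | 0 <= t <= T /\ exists i,
  pos_at G1 (Node s) (A G1 s i) t <> pos_at G2 (Node s) (A G2 s i) t]%classic.
pose pos1 i t := pos_at G1 (Node s) (A G1 s i) t.
pose pos2 i t := pos_at G2 (Node s) (A G2 s i) t.
(* Equal visited sets before [b] suffice: no visited node lies in [U], so both graphs reveal the
   same edges. *)
have knows b : 0 < b -> b <= T ->
    (forall i t v, 0 <= t < b -> pos1 i t = Node v ->
       visited G2 s (A G2 s) t v) ->
    (forall i t v, 0 <= t < b -> pos2 i t = Node v ->
       visited G1 s (A G1 s) t v) ->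
  forall i, pos1 i b = pos2 i b.
  move=> b0 le_bT v12 v21 i; apply: onA => // t' /andP[t'0 lt_t'b]; split.
    apply/seteqP; split=> v [j [t [/andP[t0 le_tt'] post]]].
      have [|j' [t'' [/andP[h1 h2] h3]]] := v12 j t v _ post.
        by rewrite t0 (le_lt_trans le_tt').
      by exists j', t''; rewrite h1 (le_trans h2).
    have [|j' [t'' [/andP[h1 h2] h3]]] := v21 j t v _ post.
      by rewrite t0 (le_lt_trans le_tt').
    by exists j', t''; rewrite h1 (le_trans h2).
  move=> u v [j [t [/andP[t0 le_tt'] post]]].
  suff /(eqU _ v)[-> ->] : ~~ U u by [].
  apply/negP => Uu; apply: unT Uu post.
  by rewrite t0 (lt_le_trans (le_lt_trans le_tt' lt_t'b)).
move=> t i tT; apply: contrapT => neq_t.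
have St : S t by split=> //; exists i.
have infS : has_inf S by split; [exists t | exists 0 => x [/andP[]]].
pose b0 := inf S; have leb0 x : S x -> b0 <= x by apply: inf_lbound; case: infS.
have b0_ge0 : 0 <= b0.
  by apply: lb_le_inf; [case: infS | move=> x [/andP[]]].
have b0_leT : b0 <= T by apply: le_trans (leb0 _ St) _; case/andP: tT.
have eq_lt x j : 0 <= x < b0 -> pos1 j x = pos2 j x.
  move=> /andP[x0 lt_x]; apply: contrapT => neq_x.
  suff /leb0 : S x by rewrite leNgt lt_x.
  by split; [rewrite x0 (le_trans (ltW lt_x)) | exists j].
have eq_b0 j : pos1 j b0 = pos2 j b0.
  move: b0_ge0; rewrite le_eqVlt => /predU1P[b0E|b0_gt0].
    rewrite /pos1 /pos2 -b0E.
    by rewrite (pos_at_le (rt1 j) (lexx _)).1 (pos_at_le (rt2 j) (lexx _)).1.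
  apply: knows => // l x v /[dup] hx /andP[x0 _] posx; exists l, x.
    by rewrite x0 lexx -/(pos2 l x) -eq_lt.
  by rewrite x0 lexx -/(pos1 l x) eq_lt.
have [e1 e1_gt0 st1] := schedule_right_stable b0 rt1.
have [e2 e2_gt0 st2] := schedule_right_stable b0 rt2.
have e_gt0 : 0 < Num.min e1 e2 by rewrite lt_min e1_gt0.
have [b [/andP[b_ge0 b_leT] [j neq_b]]] := inf_adherent e_gt0 infS.
rewrite -/b0 -ltrBlDl lt_min !ltrBlDl => /andP[lt_b1 lt_b2].
have : b0 <= b by apply: leb0; split; [rewrite b_ge0 | exists j].
rewrite le_eqVlt => /predU1P[eqb|lt_b0b];
  first by apply: neq_b; rewrite -eqb; exact: eq_b0.
apply: neq_b; apply: knows => //; first exact: le_lt_trans lt_b0b.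
- move=> l x v /andP[x0 lt_xb] posx; have [le_xb0|lt_b0x] := leP x b0.
    exists l, x; rewrite x0 lexx -/(pos2 l x); split=> //.
    move: le_xb0; rewrite le_eqVlt => /predU1P[xE|lt_x]; last by rewrite -eq_lt ?x0.
    by rewrite xE -eq_b0 -xE.
  exists l, b0; rewrite b0_ge0 (ltW lt_b0x) -/(pos2 l b0) -eq_b0; split=> //.
  by apply: st1 posx; rewrite lt_b0x (lt_trans lt_xb).
- move=> l x v /andP[x0 lt_xb] posx; have [le_xb0|lt_b0x] := leP x b0.
    exists l, x; rewrite x0 lexx -/(pos1 l x); split=> //.
    move: le_xb0; rewrite le_eqVlt => /predU1P[xE|lt_x]; last by rewrite eq_lt ?x0.
    by rewrite xE eq_b0 -xE.
  exists l, b0; rewrite b0_ge0 (ltW lt_b0x) -/(pos1 l b0) eq_b0; split=> //.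
  by apply: st2 posx; rewrite lt_b0x (lt_trans lt_xb).
Qed.

End FirstVisit.

(** * Tours and the cost of visits *)

Section Tours.
Variables (R : realType) (G : graph R).

Fixpoint tour (t : R) u (p : seq nat) : seq (leg R) :=
  if p is v :: p' then Leg t u v 0 (len G u v) :: tour (t + len G u v) v p'
  else [::].

Lemma mkpoint0 u v : mkpoint G u v 0 = Node u.
Proof. by rewrite /mkpoint lexx. Qed.

Lemma mkpoint_len u v : edge G u v -> mkpoint G u v (len G u v) = Node v.
Proof. by move=> /len_gt0 l0; rewrite /mkpoint leNgt l0 lexx. Qed.

Lemma tour_route t u p : path (edge G) u p ->
  route G (Node (last u p)) (Node u) t (tour t u p).
Proof.
elim: p t u => [//|v p IH] t u /= /andP[ed pth]; have l0 := len_gt0 ed.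
rewrite mkpoint0 mkpoint_len// /leg_end /leg_len /= subr0 (gtr0_norm l0).
by split=> //; [rewrite !lexx (ltW l0) | exact: IH].
Qed.

Lemma tour_visit t u p v : path (edge G) u p -> v \in p ->
  exists2 t', t <= t' & pos_at G (Node u) (tour t u p) t' = Node v.
Proof.
move=> pth vp; have rt := tour_route t pth.
suff [g /(route_visit rt) H <-] : exists2 g, List.In g (tour t u p) &
  mkpoint G (leg_u g) (leg_v g) (leg_y g) = Node v by exact: H.
elim: p t u pth vp {rt} => [//|w p IH] t u /= /andP[ed pth].
rewrite inE => /predU1P[->|vp].
  by exists (Leg t u w 0 (len G u w)); [left | exact: mkpoint_len].
by have [g gp gE] := IH (t + len G u w) w pth vp; exists g => //; right.
Qed.

Lemma tour_len t u v p : edge G u v ->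
  \sum_(g <- tour t u (v :: p)) leg_len g =
  len G u v + \sum_(g <- tour (t + len G u v) v p) leg_len g.
Proof.
by move=> /len_gt0 l0; rewrite big_cons {1}/leg_len /= subr0 gtr0_norm.
Qed.

End Tours.

Section VisitCost.
Variables (R : realType) (G : graph R) (s : nat) (gs : seq (leg R)).
Hypothesis closed : route G (Node s) (Node s) 0 gs.
Notation pos := (pos_at G (Node s) gs).

Lemma node_potential_le_travel (k : nat -> R) a b :
  (forall u v, edge G u v -> `|k v - k u| <= len G u v) -> a <= b ->
  `|potential G k (fun u _ => k u) (pos b) - potential G k (fun u _ => k u) (pos a)|
    <= travel gs b - travel gs a.
Proof.
move=> lip le_ab.
by apply: (@potential_le_travel _ _ _ _ pred0 lip _ _ _ _ _ closed).
Qed.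

Lemma travel_visits (k : nat -> R) a b u v :
  (forall u v, edge G u v -> `|k v - k u| <= len G u v) ->
  pos a = Node u -> pos b = Node v ->
  `|k v - k u| <= `|travel gs b - travel gs a|.
Proof.
move=> /node_potential_le_travel le_travel posa posb.
have [/le_travel|/ltW/le_travel] := leP a b; rewrite posa posb /=.
  by move/le_trans; apply; exact: ler_norm.
by rewrite (distrC (k v)) (distrC (travel gs b)) => /le_trans; apply; exact: ler_norm.
Qed.

Lemma zero_lip u v : edge G u v -> `|0 - 0 : R| <= len G u v.
Proof. by move=> /len_gt0/ltW; rewrite subrr normr0. Qed.

Lemma travel_ge0 a : 0 <= a -> 0 <= travel gs a.
Proof.
move=> /(node_potential_le_travel (k := fun=> 0) zero_lip).
by rewrite (pos_at_le closed (lexx _)).2 subr0; exact: le_trans.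
Qed.

(** The potential difference between [s] and [u] must be paid on the way to [u] and once more on the
    way back. *)
Lemma visit_cost (k : nat -> R) a u :
  (forall u v, edge G u v -> `|k v - k u| <= len G u v) ->
  0 <= a -> pos a = Node u ->
  `|k u - k s| <= travel gs a /\
  travel gs a + `|k u - k s| <= \sum_(g <- gs) leg_len g.
Proof.
move=> lip a0 posa; have [pos0 tr0] := pos_at_le closed (lexx 0).
split.
  by have := travel_visits lip pos0 posa; rewrite tr0 subr0 (ger0_norm (travel_ge0 a0)).
have [T [_ le_aT posT <-]] := route_end a closed.
have := node_potential_le_travel lip le_aT.
by rewrite posT posa /= distrC lerBrDl.
Qed.

(* The potential is [c] at [x], falls to 0 at the cut [b], and is 0 elsewhere. *)
Lemma cut_cost b x a (c : R) : 0 <= c -> x != b -> s != x -> s != b ->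
  (forall v, edge G x v -> v != b -> c <= len G x v) ->
  0 <= a -> pos a = Node x -> (forall t, 0 <= t <= a -> pos t <> Node b) ->
  c <= \sum_(g <- gs) leg_len g.
Proof.
move=> c0 xb sx sb far a0 posa unb.
(* On the edge between [x] and [b] the potential is constantly [c], so this edge may be short; the
   jump at [b] is never crossed up to time [a]. *)
pose L u v := if (u == x) || ((u == b) && (v == x)) then c else 0.
pose k u := if u == x then c else 0.
have L_lip u v : edge G u v -> `|L v u - L u v| <= len G u v.
  rewrite /L => ed; have l0 := ltW (len_gt0 ed).
  have [ux|ux] := eqVneq u x; have [vx|vx] := eqVneq v x => /=;
    rewrite ?andbF ?subrr ?normr0//=.
    subst u; case: (eqVneq v b) => /= vb; first by rewrite subrr normr0.
    by rewrite sub0r normrN ger0_norm// far.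
  subst v; case: (eqVneq u b) => /= ub; first by rewrite subrr normr0.
  by rewrite subr0 ger0_norm// len_sym far// edge_sym.
have L_node u v : edge G u v -> ~~ pred1 b u -> L u v = k u.
  by rewrite /= /L /k => _ /negbTE ->; rewrite orbF.
have [pos0 tr0] := pos_at_le closed (lexx _).
have := potential_le_travel L_lip L_node closed a0.
rewrite pos0 posa tr0 /= /k eqxx (negbTE sx) !subr0 ger0_norm// => /(_ _)/le_trans.
apply; first by move=> t ta u /eqP ->; exact: unb.
by have [_] := visit_cost (k := fun=> 0) zero_lip a0 posa; rewrite subrr normr0 addr0.
Qed.

End VisitCost.

(** * The adversarial tadpole graphs *)

(* The three edges at the start node 0 lead to 1, 2 and 3: [f] carries the long
   edge of the cycle 0 - f - 4 - g - 0, and [t] starts the tail 0 - t - 5. *)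
Inductive labelling : nat -> nat -> nat -> Prop :=
  | Lab123 : labelling 1 2 3
  | Lab132 : labelling 1 3 2
  | Lab213 : labelling 2 1 3
  | Lab231 : labelling 2 3 1
  | Lab312 : labelling 3 1 2
  | Lab321 : labelling 3 2 1.

Definition adv_edges (f g t : nat) : seq (nat * nat) :=
  [:: (0, f); (f, 4); (4, g); (g, 0); (0, t); (t, 5)]%N.

Definition adv_edge f g t : rel nat :=
  fun u v => ((u, v) \in adv_edges f g t) || ((v, u) \in adv_edges f g t).

Definition adv_nodes : {fset nat} := [fset n in iota 0 6]%fset.

Definition adv_len (R : realType) (d : R) (f g : nat) (u v : nat) : R :=
  if ((u, v) == (f, 4)) || ((v, u) == (f, 4))%N then 6
  else if ((u, v) == (4, g)) || ((v, u) == (4, g))%N then d else 1.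

Section Adversary.
Variables (R : realType) (d : R) (f g t : nat).
Hypotheses (d_gt0 : 0 < d) (lab : labelling f g t).

Lemma adv_edge_sym : symmetric (adv_edge f g t).
Proof. by move=> u v; rewrite /adv_edge orbC. Qed.

Lemma adv_edge_irr : irreflexive (adv_edge f g t).
Proof.
by move=> u; rewrite /adv_edge orbb !inE; case: lab; do 6 case: u => [|u] //.
Qed.

Lemma adv_edge_nodes u v :
  adv_edge f g t u v -> (u \in adv_nodes) && (v \in adv_nodes).
Proof.
rewrite !inE; case: lab;
  by case: u => [|[|[|[|[|[|u]]]]]]; case: v => [|[|[|[|[|[|v]]]]]].
Qed.

Lemma adv_len_sym u v : adv_len d f g u v = adv_len d f g v u.
Proof. by rewrite /adv_len (orbC ((v, u) == (f, 4))%N) (orbC ((v, u) == (4, g))%N). Qed.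

Lemma adv_len_gt0 u v : adv_edge f g t u v -> 0 < adv_len d f g u v.
Proof. by move=> _; rewrite /adv_len; case: ifP => // _; case: ifP. Qed.

Lemma adv_connected u v : u \in adv_nodes -> v \in adv_nodes ->
  exists2 p, path (adv_edge f g t) u p & last u p = v.
Proof.
(* Each node lies on one of two paths from 0; two nodes are joined by reversing a path to the first
   one. *)
have out w : w \in adv_nodes ->
    exists2 p, path (adv_edge f g t) 0 p & last 0 p = w.
  have path0 : path (adv_edge f g t) 0 [:: f; 4; g]%N /\
      path (adv_edge f g t) 0 [:: t; 5]%N.
    by case: lab.
  case: path0 => pc pt; rewrite !inE => w6.
  have : w \in [:: 0; f; 4; g; t; 5]%N.
    by move: w w6; case: lab => -[|[|[|[|[|[|w]]]]]].
  rewrite !inE => /or4P[||| /or3P[]] /eqP ->.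
  - by exists [::].
  - by exists [:: f]; move: pc => //= /andP[->].
  - by exists [:: f; 4]%N; move: pc => //= /and3P[-> ->].
  - by exists [:: f; 4; g]%N.
  - by exists [:: t]; move: pt => //= /andP[->].
  - by exists [:: t; 5]%N.
move=> /out[p pp lp] /out[q pq lq].
have lr : last u (rev (belast 0 p)) = 0%N.
  by case: (p) lp => [|x p'] //= _; rewrite rev_cons last_rcons.
exists (rev (belast 0 p) ++ q).
  rewrite cat_path lr pq andbT -lp rev_path.
  by rewrite (eq_path (e' := adv_edge f g t)) // => x y; exact: adv_edge_sym.
by rewrite last_cat lr.
Qed.

Definition adv : graph R :=
  Graph adv_edge_sym adv_edge_irr adv_edge_nodes adv_len_sym adv_len_gt0 adv_connected.

Lemma adv_tadpole : tadpole adv.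
Proof.
exists 0%N, [:: f; 4; g]%N, [:: t; 5]%N; split=> //.
- by case: lab.
- move=> u; rewrite !inE.
  by case: lab; case: u => [|[|[|[|[|[|u]]]]]].
Qed.

Lemma adv_lip (k : nat -> R) :
  `|k f - k 0%N| <= 1 -> `|k 4%N - k f| <= 6 -> `|k g - k 4%N| <= d ->
  `|k g - k 0%N| <= 1 -> `|k t - k 0%N| <= 1 -> `|k 5%N - k t| <= 1 ->
  forall u v, edge adv u v -> `|k v - k u| <= len adv u v.
Proof.
move=> h0f hf4 h4g hg0 h0t ht5.
suff H u v : (u, v) \in adv_edges f g t -> `|k v - k u| <= len adv u v.
  by move=> u v /orP[/H//|/H]; rewrite distrC len_sym.
rewrite /= !inE => /or4P[||| /or3P[]] /eqP[-> ->]; rewrite /adv_len.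
- by move: h0f; case: lab.
- by move: hf4; case: lab.
- by move: h4g; case: lab.
- by move: hg0; rewrite distrC; case: lab.
- by move: h0t; case: lab.
- by move: ht5; case: lab.
Qed.

(** Node 4 shares the value of [g]: then the tiny edge 4g is flat, and the edge f4 is long enough
    for any values in [-1, 1]. *)
Definition star_potential (cf cg ct c5 : R) (u : nat) : R :=
  if u == 0%N then 0 else if u == f then cf else if u == t then ct
  else if u == 5%N then c5 else cg.

Lemma star_potentialE cf cg ct c5 (k := star_potential cf cg ct c5) :
  [/\ k 0%N = 0, k f = cf, k g = cg, k t = ct & k 4%N = cg /\ k 5%N = c5].
Proof. by rewrite /k /star_potential; case: lab. Qed.

Lemma star_lip cf cg ct c5 : -1 <= cf <= 1 -> -1 <= cg <= 1 -> -1 <= ct <= 1 ->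
  `|c5 - ct| <= 1 ->
  forall u v, edge adv u v ->
    `|star_potential cf cg ct c5 v - star_potential cf cg ct c5 u| <= len adv u v.
Proof.
move=> hf hg ht h5; apply: adv_lip;
  have [k0 kf kg kt [k4 k5]] := star_potentialE cf cg ct c5;
  rewrite ?k0 ?kf ?kg ?kt ?k4 ?k5 ?subr0 ?subrr ?normr0 ?(ltW d_gt0)// ler_norml//.
by case/andP: hf hg => ? ? /andP[? ?]; apply/andP; split; lra.
Qed.

(** * Costs of one closed route in an adversarial graph *)

Section Route.
Variable gs : seq (leg R).
Hypothesis closed : route adv (Node 0%N) (Node 0%N) 0 gs.
Notation pos := (pos_at adv (Node 0%N) gs).
Notation cost := (\sum_(g <- gs) leg_len g).

Lemma cost_f a : 0 <= a -> pos a = Node f -> 2 <= cost.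
Proof.
move=> a0 posa.
have lip : forall u v, edge adv u v ->
    `|star_potential 1 0 0 0 v - star_potential 1 0 0 0 u| <= len adv u v.
  by apply: star_lip; rewrite ?subrr ?normr0 //; apply/andP; split; lra.
have := visit_cost closed lip a0 posa.
have [-> -> _ _ _] := star_potentialE 1 0 0 0.
by rewrite !subr0 normr1 => -[? ?]; lra.
Qed.

(** Node 5 is at distance 2 from 0 and 3 from [u], and [u] is at distance 1 from 0; in either order
    this gives 2 + 3 + 1. *)
Lemma cost_tail_cycle a b u : 0 <= a -> 0 <= b -> u \in [:: f; g] ->
  pos a = Node 5%N -> pos b = Node u -> 6 <= cost.
Proof.
move=> a0 b0 ufg posa posb.
have lip : forall u v, edge adv u v -> `|star_potential 1 1 (-1) (-2) v
    - star_potential 1 1 (-1) (-2) u| <= len adv u v.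
  by apply: star_lip; rewrite ?ler_norml; apply/andP; split; lra.
have := travel_visits closed lip posa posb.
have := visit_cost closed lip a0 posa; have := visit_cost closed lip b0 posb.
have [-> kf kg _ [_ ->]] := star_potentialE 1 1 (-1) (-2).
have -> : star_potential 1 1 (-1) (-2) u = 1.
  by move: ufg; rewrite !inE => /orP[] /eqP ->.
rewrite !subr0 normr1 normrN normr_nat opprK ger0_norm; last lra.
by rewrite ler_normr => -[? ?] [? ?] /orP[] ?; lra.
Qed.

(** The three neighbours of 0 are at pairwise distance 2, so any order costs 1 + 2 + 2 + 1. No
    potential with values in [-1, 1] separates all three pairs by 2, so each pair gets its own. *)
Lemma cost_three a b c : 0 <= a -> 0 <= b -> 0 <= c ->
  pos a = Node f -> pos b = Node g -> pos c = Node t -> 6 <= cost.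
Proof.
move=> a0 b0 c0 posa posb posc.
have lip cf cg ct : -1 <= cf <= 1 -> -1 <= cg <= 1 -> -1 <= ct <= 1 ->
    forall u v, edge adv u v -> `|star_potential cf cg ct ct v
      - star_potential cf cg ct ct u| <= len adv u v.
  by move=> *; apply: star_lip => //; rewrite subrr normr0.
have h0 : -1 <= (0 : R) <= 1 by apply/andP; split; lra.
have h1 : -1 <= (1 : R) <= 1 by apply/andP; split; lra.
have hN1 : -1 <= (-1 : R) <= 1 by apply/andP; split; lra.
have lip1 := lip _ _ _ hN1 h1 h0.
have lip2 := lip _ _ _ hN1 h0 h1.
have lip3 := lip _ _ _ h0 hN1 h1.
have := visit_cost closed lip1 a0 posa; have := visit_cost closed lip1 b0 posb.
have := visit_cost closed lip2 c0 posc.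
have := travel_visits closed lip1 posa posb.
have := travel_visits closed lip2 posa posc.
have := travel_visits closed lip3 posb posc.
have [k10 k1f k1g _ _] := star_potentialE (-1) 1 0 0.
have [k20 k2f _ k2t _] := star_potentialE (-1) 0 1 1.
have [_ _ k3g k3t _] := star_potentialE 0 (-1) 1 1.
rewrite k10 k1f k1g k20 k2f k2t k3g k3t !subr0 normrN normr1 opprK ger0_norm; last lra.
by rewrite !ler_normr => /orP[] ? /orP[] ? /orP[] ? [? ?] [? ?] [? ?]; lra.
Qed.

(** Without passing [g], node 4 is entered only over the edge f4, of length 6. *)
Lemma visit_4_after_g a : cost < 6 -> 0 <= a ->
  (forall b, 0 <= b <= a -> pos b <> Node g) -> pos a <> Node 4%N.
Proof.
move=> cheap a0 unb posa; have : 6 <= cost; last by rewrite leNgt cheap.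
apply: (cut_cost closed _ _ _ _ _ a0 posa unb) => //; try by case: lab.
move=> v; rewrite /= /adv_edge /adv_len !inE.
by case: lab; case: v => [|[|[|[|[|[|v]]]]]].
Qed.

(** The only neighbour of 5 is the cut [t], so the length condition of [cut_cost] is vacuous. *)
Lemma visit_5_after_t a : cost < 6 -> 0 <= a ->
  (forall b, 0 <= b <= a -> pos b <> Node t) -> pos a <> Node 5%N.
Proof.
move=> cheap a0 unb posa; have : 6 <= cost; last by rewrite leNgt cheap.
apply: (cut_cost closed _ _ _ _ _ a0 posa unb) => //; try by case: lab.
move=> v; rewrite /= /adv_edge /adv_len !inE.
by case: lab; case: v => [|[|[|[|[|[|v]]]]]].
Qed.

End Route.

End Adversary.

(** * Cheap schedules on the adversarial graphs *)

Lemma eq_of_neq_I2 (i j k : 'I_2) : i != k -> j != k -> i = j.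
Proof.
by case: i j k => [[|[|?]] ?] [[|[|?]] ?] [[|[|?]] ?] //= _ _; apply/val_inj.
Qed.

Section AdversarySchedule.
Variables (R : realType) (d : R) (f g t : nat).
Hypotheses (d_gt0 : 0 < d) (lab : labelling f g t).
Notation G := (adv d_gt0 lab).
Variable P : schedule R 2.
Hypothesis expl : exploration G 0 P.
Notation pos i := (pos_at G (Node 0%N) (P i)).

Lemma explored u : (u < 6)%N -> exists i, exists2 a, 0 <= a & pos i a = Node u.
Proof.
move=> u6; have [|T [i [a [/andP[a0 _] posa]]]] := expl.2 u.
  by rewrite !inE; move: u6; case: u => [|[|[|[|[|[|u]]]]]].
by exists i, a.
Qed.

Lemma le_energy i : \sum_(g <- P i) leg_len g <= energy P.
Proof. exact: (le_bigmax _ (fun i => \sum_(g <- P i) leg_len g)). Qed.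

(** Keeps the optimum away from 0, so that the ratio can be multiplied out. *)
Lemma energy_ge2 : 2 <= energy P.
Proof.
have [|i [a a0 posa]] := @explored f; first by case: lab.
exact: le_trans (cost_f (expl.1 i) a0 posa) (le_energy i).
Qed.

Hypothesis cheap : energy P < 6.

Lemma cheap_agent i : \sum_(g <- P i) leg_len g < 6.
Proof. exact: le_lt_trans (le_energy i) cheap. Qed.

(* The agent that explores the tail can afford neither [f] nor [g], so the
   other one visits both of them and cannot afford [t]. *)
Lemma agent_roles i j a b : 0 <= a -> 0 <= b -> pos i a = Node f ->
  (pos j b = Node g -> i = j) /\ (pos j b = Node t -> i <> j).
Proof.
move=> a0 b0 posa.
have [//|k [c c0 posc]] := @explored 5.
have off l e u : 0 <= e -> u \in [:: f; g] -> pos l e = Node u -> l != k.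
  move=> e0 ufg pose; apply/eqP => lk; subst l.
  have := cost_tail_cycle (expl.1 k) c0 e0 ufg posc pose.
  by rewrite leNgt cheap_agent.
have ik : i != k by apply: off posa => //; rewrite !inE eqxx.
split=> [posb|posb ij].
  by apply: (eq_of_neq_I2 ik); apply: off posb => //; rewrite !inE eqxx orbT.
subst j; have [|l [e e0 pose]] := @explored g; first by case: lab.
have il : i = l.
  by apply: (eq_of_neq_I2 ik); apply: off pose => //; rewrite !inE eqxx orbT.
subst l; have := cost_three (expl.1 i) a0 e0 b0 posa pose posb.
by rewrite leNgt cheap_agent.
Qed.

Lemma first_visit_adjacent (U : pred nat) T i u :
  0 <= T -> unvisited_before G 0 P U T -> U g -> U t -> pos i T = Node u ->
  u <> 4%N /\ u <> 5%N.
Proof.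
move=> T0 unT Ug Ut posT.
(* At time [T] itself the agent is at a node other than [v], so the half-open interval can be
   closed. *)
have unv v w : U v -> pos i T = Node w -> v <> w ->
    forall b, 0 <= b <= T -> pos i b <> Node v.
  move=> Uv posw neq b /andP[b0]; rewrite le_eqVlt => /predU1P[->|lt_b].
    by rewrite posw => -[/esym].
  by apply: unT Uv; rewrite b0.
split=> uE; subst u.
  apply: (visit_4_after_g (expl.1 i) (cheap_agent i) T0 _ posT).
  by apply: (unv _ _ Ug posT); case: lab.
apply: (visit_5_after_t (expl.1 i) (cheap_agent i) T0 _ posT).
by apply: (unv _ _ Ut posT); case: lab.
Qed.

End AdversarySchedule.

(** * The offline optimum of the adversarial graphs *)

Section AdversaryOpt.
Variables (R : realType) (d : R) (f g t : nat).
Hypotheses (d_gt0 : 0 < d) (lab : labelling f g t).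
Notation G := (adv d_gt0 lab).

Definition offline_schedule : schedule R 2 := fun i =>
  if i == ord0 then tour G 0 0 [:: f; 0; g; 4; g; 0]%N
  else tour G 0 0 [:: t; 5; t; 0]%N.

Lemma offline_paths : path (edge G) 0 [:: f; 0; g; 4; g; 0]%N /\
  path (edge G) 0 [:: t; 5; t; 0]%N.
Proof. by rewrite /= /adv_edge; case: lab. Qed.

Lemma offline_exploration : exploration G 0 offline_schedule.
Proof.
have [p1 p2] := offline_paths; split=> [i|v].
  by rewrite /offline_schedule; case: ifP => _;
    [apply: (tour_route 0 p1) | apply: (tour_route 0 p2)].
rewrite !inE => v6.
have : (v \in [:: f; 0; g; 4; g; 0]%N) || (v \in [:: t; 5; t; 0]%N).
  by move: v v6; case: lab => -[|[|[|[|[|[|v]]]]]].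
case/orP => [/(tour_visit 0 p1)|/(tour_visit 0 p2)] [T T0 posT]; exists T.
  by exists ord0, T; rewrite T0 lexx.
by exists ord_max, T; rewrite T0 lexx.
Qed.

Lemma offline_energy : d <= 1 -> energy offline_schedule <= 4 + 2 * d.
Proof.
move=> d1; apply: bigmax_le => [|i _]; first by have := d_gt0; lra.
have [p1 p2] := offline_paths; have d0 := d_gt0.
rewrite /offline_schedule; case: ifP => _.
  have := p1; rewrite [path _ _ _]/= => /and5P[e1 e2 e3 e4 /and3P[e5 e6 _]].
  rewrite !tour_len// big_nil /= /adv_len.
  by case: lab => /=; lra.
have := p2; rewrite [path _ _ _]/= => /and5P[e1 e2 e3 e4 _].
rewrite !tour_len// big_nil /= /adv_len.
by case: lab => /=; lra.
Qed.

Lemma adv_opt : d <= 1 -> 2 <= opt G 0 2 /\ opt G 0 2 <= 4 + 2 * d.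
Proof.
move=> d1; have lb : lbound [set energy P | P in
    [set P : schedule R 2 | exploration G 0 P]]%classic 2.
  by move=> _ [P expl <-]; exact: energy_ge2 expl.
split.
  by apply: lb_le_inf lb; exists (energy offline_schedule), offline_schedule => //;
    exact: offline_exploration.
apply: le_trans (offline_energy d1); apply: inf_lbound.
  by exists 2.
by exists offline_schedule => //; exact: offline_exploration.
Qed.

End AdversaryOpt.

(** * The lower bound *)

(** Outside the listed nodes only 0 carries edges, and its three unit edges are common to all
    labellings. *)
Lemma adv_agree_start (R : realType) (d : R) (d_gt0 : 0 < d) f g t f' g' t'
    (lab : labelling f g t) (lab' : labelling f' g' t') u v :
  u \notin [:: 1; 2; 3; 4; 5]%N ->
  edge (adv d_gt0 lab) u v = edge (adv d_gt0 lab') u v /\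
  len (adv d_gt0 lab) u v = len (adv d_gt0 lab') u v.
Proof.
rewrite /= /adv_edge /adv_len !inE.
by case: u => [|[|[|[|[|[|u]]]]]] // _; case: lab; case: lab';
  case: v => [|[|[|[|[|[|v]]]]]].
Qed.

(** At [f] both instances show a unit edge to 0 and an edge of length 6 to 4, so visiting [f] does
    not reveal which branch is the tail. *)
Lemma adv_agree_swap (R : realType) (d : R) (d_gt0 : 0 < d) f g t
    (lab : labelling f g t) (lab' : labelling f t g) u v :
  u \notin [:: g; t; 4; 5]%N ->
  edge (adv d_gt0 lab) u v = edge (adv d_gt0 lab') u v /\
  len (adv d_gt0 lab) u v = len (adv d_gt0 lab') u v.
Proof.
rewrite /= /adv_edge /adv_len !inE; move: u v.
by case: lab => {lab'} -[|[|[|[|[|[|u]]]]]] // [|[|[|[|[|[|v]]]]]].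
Qed.

Lemma labelling_of_first u :
  u \in [:: 1; 2; 3]%N -> exists g t, labelling u g t /\ labelling u t g.
Proof.
rewrite !inE => /or3P[] /eqP ->.
- by exists 2%N, 3%N; split; constructor.
- by exists 1%N, 3%N; split; constructor.
- by exists 1%N, 2%N; split; constructor.
Qed.

Lemma no_cheap_strategy (R : realType) (d : R) (d_gt0 : 0 < d) (A : strategy R 2) :
  online_exploration_strategy (@tadpole R) A ->
  (forall f g t (lab : labelling f g t), energy (A (adv d_gt0 lab) 0%N) < 6) ->
  False.
Proof.
move=> [explA onA] cheap.
have expl f g t (lab : labelling f g t) :
    exploration (adv d_gt0 lab) 0 (A (adv d_gt0 lab) 0%N).
  by apply: explA; [exact: adv_tadpole | rewrite !inE].
have s_in f g t (lab : labelling f g t) : 0%N \in nodes (adv d_gt0 lab).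
  by rewrite !inE.
(* The labelling 1, 2, 3 is only a reference: up to the first visit the run is the same for all
   labellings. *)
have [//|i0 [a0 a0_ge0 posa0]] := @explored _ _ _ _ _ _ _ _ (expl _ _ _ Lab123) 1.
have [T [i [f [T0 posf Uf unT]]]] := first_visit
  (U := mem [:: 1; 2; 3; 4; 5]%N) (expl _ _ _ Lab123).1 a0_ge0 posa0 isT.
have [f4 f5] := first_visit_adjacent (expl _ _ _ Lab123) (cheap _ _ _ Lab123)
  T0 unT isT isT posf.
have [|g [t [lab lab']]] := @labelling_of_first f.
  by move: Uf f4 f5; rewrite /= !inE => /or4P[||| /orP[]] /eqP ->.
pose G1 := adv d_gt0 lab; pose G2 := adv d_gt0 lab'.
have eq01 := online_agree onA (adv_tadpole d_gt0 Lab123) (adv_tadpole d_gt0 lab)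
  (s_in _ _ _ _) (s_in _ _ _ _) (expl _ _ _ _).1 (expl _ _ _ _).1
  (adv_agree_start d_gt0 Lab123 lab) unT.
have posf1 : pos_at G1 (Node 0%N) (A G1 0%N i) T = Node f.
  by rewrite -eq01 ?posf // T0 lexx.
have [//|i1 [a1 a1_ge0 posa1]] := @explored _ _ _ _ _ _ _ _ (expl _ _ _ lab) 4.
have U4 : mem [:: g; t; 4; 5]%N 4%N by rewrite /= !inE !orbT.
have Ug : mem [:: g; t; 4; 5]%N g by rewrite /= !inE eqxx.
have Ut : mem [:: g; t; 4; 5]%N t by rewrite /= !inE eqxx orbT.
have [T' [j [u [T'0 posu Uu unT']]]] :=
  first_visit (expl _ _ _ lab).1 a1_ge0 posa1 U4.
have [u4 u5] := first_visit_adjacent (expl _ _ _ lab) (cheap _ _ _ lab)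
  T'0 unT' Ug Ut posu.
(* Needed so that the agreement of both instances up to [T'] also covers the visit of [f] at [T]. *)
have le_TT' : T <= T'.
  rewrite leNgt; apply/negP => lt_T'T.
  have U0u : mem [:: 1; 2; 3; 4; 5]%N u.
    by move: Uu; rewrite /= !inE; case: (lab) => /or4P[] /eqP ->.
  apply: (unT T' j u _ U0u); first by rewrite T'0.
  by rewrite eq01 // T'0 ltW.
have eq12 := online_agree onA (adv_tadpole d_gt0 lab) (adv_tadpole d_gt0 lab')
  (s_in _ _ _ _) (s_in _ _ _ _) (expl _ _ _ _).1 (expl _ _ _ _).1
  (adv_agree_swap d_gt0 lab lab') unT'.
have posf2 : pos_at G2 (Node 0%N) (A G2 0%N i) T = Node f.
  by rewrite -eq12 ?posf1 // T0.
have posu2 : pos_at G2 (Node 0%N) (A G2 0%N j) T' = Node u.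
  by rewrite -eq12 ?posu // T'0 lexx.
have [same1 other1] :=
  @agent_roles _ _ _ _ _ _ _ _ (expl _ _ _ lab) (cheap _ _ _ lab) i j T T' T0 T'0 posf1.
have [same2 other2] :=
  @agent_roles _ _ _ _ _ _ _ _ (expl _ _ _ lab') (cheap _ _ _ lab') i j T T' T0 T'0 posf2.
(* If [u] is [g], it is on the cycle for [lab], forcing [i = j], and on the tail for [lab'], forcing
   [i <> j]. If [u] is [t], the instances change places. *)
move: Uu u4 u5; rewrite /= !inE => /or4P[] /eqP uE // _ _; subst u.
  exact: other2 posu2 (same1 posu).
exact: other1 posu (same2 posu2).
Qed.

Theorem theorem6 (R : realType) :
  ~ exists A : strategy R 2,
      online_exploration_strategy (@tadpole R) A /\
      (competitive_ratio (@tadpole R) A < (3 / 2)%:E)%E.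
Proof.
case=> A [strA lt_ratio].
have ratio_le d (d_gt0 : 0 < d) f g t (lab : labelling f g t) :
    ((energy (A (adv d_gt0 lab) 0%N) / opt (adv d_gt0 lab) 0 2)%:E
     <= competitive_ratio (@tadpole R) A)%E.
  apply: ereal_sup_ubound; exists (adv d_gt0 lab), 0%N; split=> //.
    exact: adv_tadpole.
  by rewrite !inE.
(* A real bound that is at least 1 also covers the value -oo, and it makes [c] positive and [d] at
   most 1. *)
have [c c1 [c32 le_c]] : exists2 c : R, 1 <= c & c < 3 / 2 /\
    (competitive_ratio (@tadpole R) A <= c%:E)%E.
  move: lt_ratio; case: (competitive_ratio _ _) => [r||] //; last first.
    by exists 1 => //; split; [lra | rewrite leNye].
  rewrite lte_fin => lt_r; exists (Num.max r 1); rewrite ?le_max ?lexx ?orbT//.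
  by rewrite gt_max lt_r lee_fin le_max lexx; split=> //=; lra.
(* With this [d], 6 - c(4 + 2d) = (3/2 - c)(4 - c), which is positive. *)
pose d := (3 - 2 * c) / 4; have d_gt0 : 0 < d by rewrite /d; lra.
apply: (@no_cheap_strategy _ _ d_gt0 _ strA) => f g t lab.
have [|opt2 opt_le] := adv_opt d_gt0 lab; first by rewrite /d; lra.
have := le_trans (ratio_le _ d_gt0 _ _ _ lab) le_c.
rewrite lee_fin ler_pdivrMr; last by lra.
move=> le_e; apply: le_lt_trans le_e _.
apply: (@le_lt_trans _ _ (c * (4 + 2 * d))); first by rewrite ler_wpM2l//; lra.
have : 0 < (3 / 2 - c) * (4 - c) by apply: mulr_gt0; lra.
by rewrite /d; nra.
Qed.
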